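(* Assume that $F:\mathbb{R}^d\to\mathbb{R}$ is twice continuously differentiable and that there exist positive constants $\mu$ and $L$ with $\mu I\preceq\nabla^2F(w)\preceq LI$ for all $w\in\mathbb{R}^d$. Let $F^\star=F(w^\star)$, where $w^\star=\arg\min_{w\in\mathbb{R}^d}F(w)$. Let $\{w_k\}_{k\ge0}$ be the iterates generated by the FLECS algorithm (with either Hessian approximation update and either search direction option), so that $w_{k+1}=w_k-\alpha_kA_k\nabla F(w_k)$, and let $0<\mu_1\le\mu_2$ be constants such that $\mu_1I\preceq A_k\preceq\mu_2I$ for all $k\ge0$. If the step-size is constant, $\alpha_k=\alpha$, with $0<\alpha\le\frac{\mu_1}{\mu_2^2L}$, then for all $k\ge0$ $$F(w_k)-F^\star\le(1-\alpha\mu\mu_1)^k\,[F(w_0)-F^\star].$$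
   Context: Problem: minimize $F(w)=\frac1n\sum_{i=1}^nf_i(w)$ over $w\in\mathbb{R}^d$, where $f_i$ is the loss of the $i$-th worker (the gradients and Hessians of $f_i$ used below are assumed to exist). $\|\cdot\|$ is the Euclidean norm, $\preceq$ is the Loewner order, $\dagger$ is the Moore–Penrose pseudo-inverse. Truncation: for a symmetric matrix $B=V\Lambda V^T$ (eigendecomposition with $V$ having orthonormal columns and $\Lambda$ diagonal) and $0<\omega\le\Omega$, let $|\Lambda|_\omega^\Omega$ be the diagonal matrix with entries $\min\{\max\{|\Lambda_{ii}|,\omega\},\Omega\}$, and $(|B|_\omega^\Omega)^{-1}:=V(|\Lambda|_\omega^\Omega)^{-1}V^T$. FLECS algorithm. Inputs: starting point $w_0$, memory size $m\le d$, symmetric initial matrices $B_0^i\in\mathbb{R}^{d\times d}$ ($i=1,\dots,n$), truncation constants $0<\omega<\Omega$, a (possibly random, biased or unbiased) compression operator $\mathcal{C}:\mathbb{R}^{d\times m}\to\mathbb{R}^{d\times m}$. At iteration $k\ge0$: 1. A sketching matrix $S_k\in\mathbb{R}^{d\times m}$ is sampled (the same on all machines). Worker $i$ computes $Y_k^i=\nabla^2f_i(w_k)S_k$, $M_k^i=S_k^TY_k^i$, $\nabla f_i(w_k)$, and $C_k^i=\mathcal{C}(Y_k^i-B_k^iS_k)$. 2. The server forms $\widetilde Y_k^i=C_k^i+B_k^iS_k$ and updates $B_k^i$ by one of: (a) Truncated L-SR1 update: with spectral decomposition $M_k^i-S_k^TB_k^iS_k=U_k^iL_k^i(U_k^i)^T$,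 let $[(L_k^i)^{-1}]_\omega$ be the (pseudo-)inverse of the diagonal matrix $L_k^i$ with all entries of absolute value at most $\omega$ set to $0$, and set $B_{k+1}^i=B_k^i+(\widetilde Y_k^i-B_k^iS_k)U_k^i[(L_k^i)^{-1}]_\omega(U_k^i)^T(\widetilde Y_k^i-B_k^iS_k)^T$; (b) Direct update: $B_{k+1}^i=(1-\beta_k)B_k^i+\beta_k\widetilde Y_k^i(M_k^i)^\dagger(\widetilde Y_k^i)^T$ with a learning rate $0<\beta_k\le1$. 3. The server forms $\nabla F(w_k)=\frac1n\sum_i\nabla f_i(w_k)$, $\widetilde Y_k=\frac1n\sum_i\widetilde Y_k^i$, $M_k=\frac1n\sum_iM_k^i$, $B_{k+1}=\frac1n\sum_iB_{k+1}^i$, and sets $w_{k+1}=w_k+\alpha_kp_k$ with $p_k=-A_k\nabla F(w_k)$, where $A_k$ is one of: (a) Truncated inverse Hessian approximation: $A_k=(|B_{k+1}|_\omega^\Omega)^{-1}$; (b) FedSONIA: take an economy QR factorization $\widetilde Y_k=Q_kR_k$ ($Q_k\in\mathbb{R}^{d\times m}$ with orthonormal columns, $R_k\in\mathbb{R}^{m\times m}$ upper triangular), the spectral decomposition $R_kM_k^\dagger R_k^T=V_k\Lambda_kV_k^T$, $\widetilde V_k=Q_kV_k$, and $A_k=\widetilde V_k(|\Lambda_k|_\omega^\Omega)^{-1}\widetilde V_k^T+\rho_k(I-\widetilde V_k\widetilde V_k^T)$, where $\rho_k\in\left[\frac1\Omega,\ \frac{1}{\max_i[(|\Lambda_k|_\omega^\Omega)^{-1}]_{ii}}\right]$.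 *)

(* Defs.v *)
From HB Require Import structures.
From mathcomp Require Import all_boot all_order all_algebra.
From mathcomp Require Import all_classical all_reals all_analysis.

Set Implicit Arguments.
Unset Strict Implicit.
Unset Printing Implicit Defensive.

Import Order.TTheory GRing.Theory Num.Theory.
Import numFieldNormedType.Exports.

Local Open Scope classical_set_scope.
Local Open Scope ring_scope.

(* Points of R^d are column vectors.  The library norm on matrices is the
   sup norm; it is used only through the topology and differentiability it
   induces, which are the Euclidean ones. *)

Section calculus.
Context {R : realType} {d : nat}.
Implicit Types (f : 'cV[R]_d -> R) (x : 'cV[R]_d).

Definition gradient f x : 'cV[R]_d := \col_i 'D_(delta_mx i 0) f x.

Definition hessian f x : 'M[R]_d :=
  \matrix_(i, j) 'D_(delta_mx j 0) (fun y => 'D_(delta_mx i 0) f y) x.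

Definition twice_differentiable_at f x : Prop :=
  (\forall y \near x, differentiable f y) /\ differentiable (gradient f) x.

Definition twice_continuously_differentiable f : Prop :=
  [/\ forall x, differentiable f x,
      forall x, differentiable (gradient f) x
    & continuous (hessian f)].

End calculus.

Section matrices.
Context {R : realType}.

Definition psdmx {d} (A : 'M[R]_d) : Prop :=
  A^T = A /\ forall v : 'cV[R]_d, 0 <= (v^T *m A *m v) 0 0.

Definition loewner {d} (A B : 'M[R]_d) : Prop := psdmx (B - A).

(* [X] is the Moore-Penrose pseudo-inverse of [A], i.e. the unique matrix
   satisfying the four Penrose equations ([pinvmx] need not satisfy the last
   two). *)
Definition is_mp_pinv {p q} (A : 'M[R]_(p, q)) (X : 'M[R]_(q, p)) : Prop :=
  [/\ A *m X *m A = A, X *m A *m X = X,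
      (A *m X)^T = A *m X & (X *m A)^T = X *m A].

Definition is_spectral_decomp {d} (B V : 'M[R]_d) (lam : 'rV[R]_d) : Prop :=
  V^T *m V = 1%:M /\ B = V *m diag_mx lam *m V^T.

Definition clip (om Om x : R) : R := Num.min (Num.max `|x| om) Om.

(* Diagonal of the inverse of |diag lam|_om^Om. *)
Definition clip_inv {d} (om Om : R) (lam : 'rV[R]_d) : 'rV[R]_d :=
  map_mx (fun x => (clip om Om x)^-1) lam.

(* X = (|B|_om^Om)^-1; X does not depend on the eigendecomposition of B. *)
Definition is_truncated_inverse {d} (om Om : R) (B X : 'M[R]_d) : Prop :=
  exists (V : 'M[R]_d) (lam : 'rV[R]_d),
    is_spectral_decomp B V lam /\
    X = V *m diag_mx (clip_inv om Om lam) *m V^T.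

(* Diagonal of the pseudo-inverse of diag lam with the entries of absolute
   value at most om set to 0 (note that 0^-1 = 0). *)
Definition thresholded_pinv {d} (om : R) (lam : 'rV[R]_d) : 'rV[R]_d :=
  map_mx (fun x => (if `|x| <= om then 0 else x)^-1) lam.

Definition is_economy_QR {d m} (Y Q : 'M[R]_(d, m)) (T : 'M[R]_m) : Prop :=
  [/\ Y = Q *m T, Q^T *m Q = 1%:M
    & forall i j : 'I_m, (j < i)%N -> T i j = 0].

Definition average {n p q} (X : 'I_n -> 'M[R]_(p, q)) : 'M[R]_(p, q) :=
  n%:R^-1 *: \sum_(i < n) X i.

End matrices.

Section flecs.
Context {R : realType} {d m n : nat}.

Inductive hessian_update := TruncatedLSR1 | DirectUpdate.
Inductive search_direction := TruncatedInverseHessian | FedSONIA.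

(* A random compression operator is a function of its argument and of the
   outcome of a random draw in an arbitrary type [draw]; nothing is assumed on
   the law of the draws. *)
Record flecs_input := FlecsInput {
  w_init : 'cV[R]_d;
  B_init : 'I_n -> 'M[R]_d;
  omega : R;
  Omega : R;
  draw : Type;
  compress : draw -> 'M[R]_(d, m) -> 'M[R]_(d, m);
  update_option : hessian_update;
  direction_option : search_direction }.

Definition valid_input (inp : flecs_input) : Prop :=
  [/\ (m <= d)%N, forall i, (B_init inp i)^T = B_init inp i
    & 0 < omega inp < Omega inp].

(* One realization of the random choices of the algorithm (sketches [skt] and
   compression draws [cdraw]), of its parameters, and of the sequences it
   generates. *)
Record flecs_trace (inp : flecs_input) := FlecsTrace {
  skt : nat -> 'M[R]_(d, m);
  cdraw : nat -> 'I_n -> draw inp;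
  alpha_ : nat -> R;
  beta_ : nat -> R;
  rho_ : nat -> R;
  w_ : nat -> 'cV[R]_d;
  B_ : nat -> 'I_n -> 'M[R]_d;
  A_ : nat -> 'M[R]_d }.

Definition truncated_LSR1_update (om : R) (S : 'M[R]_(d, m))
    (M : 'M[R]_m) (Yt : 'M[R]_(d, m)) (B B' : 'M[R]_d) : Prop :=
  exists (U : 'M[R]_m) (l : 'rV[R]_m),
    is_spectral_decomp (M - S^T *m B *m S) U l /\
    B' = B + (Yt - B *m S) *m U *m diag_mx (thresholded_pinv om l)
             *m U^T *m (Yt - B *m S)^T.

Definition direct_update (beta : R)
    (M : 'M[R]_m) (Yt : 'M[R]_(d, m)) (B B' : 'M[R]_d) : Prop :=
  0 < beta <= 1 /\
  exists Mp : 'M[R]_m, is_mp_pinv M Mp /\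
    B' = (1 - beta) *: B + beta *: (Yt *m Mp *m Yt^T).

Definition fedsonia_direction (om Om rho : R)
    (M : 'M[R]_m) (Yt : 'M[R]_(d, m)) (A : 'M[R]_d) : Prop :=
  exists (Q : 'M[R]_(d, m)) (T Mp V : 'M[R]_m) (lam : 'rV[R]_m),
    let Vt := Q *m V in
    [/\ is_economy_QR Yt Q T,
        is_mp_pinv M Mp,
        is_spectral_decomp (T *m Mp *m T^T) V lam,
        Om^-1 <= rho <= (\big[Num.max/0]_(i < m) clip_inv om Om lam 0 i)^-1
      & A = Vt *m diag_mx (clip_inv om Om lam) *m Vt^T
            + rho *: (1%:M - Vt *m Vt^T)].

Definition flecs_step (f : 'I_n -> 'cV[R]_d -> R) (inp : flecs_input)
    (tr : flecs_trace inp) (k : nat) : Prop :=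
  let S := skt tr k in
  let B := B_ tr k in
  let B' := B_ tr k.+1 in
  let Y i := hessian (f i) (w_ tr k) *m S in
  let M i := S^T *m Y i in
  let C i := compress (cdraw tr k i) (Y i - B i *m S) in
  let Yt i := C i + B i *m S in
  let g := average (fun i => gradient (f i) (w_ tr k)) in
  let p := - (A_ tr k *m g) in
  [/\ forall i, match update_option inp with
        | TruncatedLSR1 =>
            truncated_LSR1_update (omega inp) S (M i) (Yt i) (B i) (B' i)
        | DirectUpdate => direct_update (beta_ tr k) (M i) (Yt i) (B i) (B' i)
        end,
      match direction_option inp with
        | TruncatedInverseHessian =>
            is_truncated_inverse (omega inp) (Omega inp) (average B') (A_ tr k)
        | FedSONIA =>
            fedsonia_direction (omega inp) (Omega inp) (rho_ tr k)
              (average M) (average Yt) (A_ tr k)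
        end
    & w_ tr k.+1 = w_ tr k + alpha_ tr k *: p].

Definition flecs_run (f : 'I_n -> 'cV[R]_d -> R) (inp : flecs_input)
    (tr : flecs_trace inp) : Prop :=
  [/\ w_ tr 0 = w_init inp, B_ tr 0 = B_init inp
    & forall k, flecs_step f tr k].

End flecs.

Arguments flecs_input : clear implicits.

(* Main.v *)
Require Import Defs.
From HB Require Import structures.
From mathcomp Require Import all_boot all_order all_algebra.
From mathcomp Require Import all_classical all_reals all_analysis.
From mathcomp Require Import lra.

Import Order.TTheory GRing.Theory Num.Theory.
Import numFieldNormedType.Exports.

Local Open Scope classical_set_scope.
Local Open Scope ring_scope.

(** The estimate is the classical analysis of a preconditioned gradient method
    and only sees the iteration [w' = w - alpha A g], with [g] the gradient of
    [F] at [w]; how FLECS builds [A] matters only through the spectral bounds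
    [mu1 I <= A <= mu2 I].

    Restricting [F] to segments and using Taylor's formula at order two, the
    Hessian bounds become two quadratic models: [F (w + v)] lies between
    [F w + <g, v> + mu / 2 |v|^2] and [F w + <g, v> + L / 2 |v|^2]
    ([quadratic_lower_bound], [quadratic_upper_bound]).

    The upper model at [v = - alpha A g], with [|A g|^2 <= mu2 <g, A g>]
    ([sqnorm_mulmx_le]) and [alpha <= mu1 / (mu2^2 L) <= 1 / (mu2 L)], gives
    [F w' <= F w - alpha / 2 <g, A g> <= F w - alpha mu1 / 2 |g|^2].
    The lower model, minimized over [v], gives the Polyak-Lojasiewicz inequality
    [2 mu (F w - F wstar) <= |g|^2] ([polyak_lojasiewicz]).  Together they say
    that one step contracts the optimality gap by [1 - alpha mu mu1], and the
    theorem follows by iteration. *)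

(** * Inner products and Loewner bounds *)

Section inner_product.
Context {R : realType} {d : nat}.
Implicit Types (u v w : 'cV[R]_d) (A : 'M[R]_d) (c : R).

Definition dot u v : R := (u^T *m v) 0 0.

Lemma dotE u v : dot u v = \sum_i u i 0 * v i 0.
Proof. by rewrite /dot mxE; apply: eq_bigr => i _; rewrite mxE. Qed.

Lemma dotC u v : dot u v = dot v u.
Proof. by rewrite !dotE; apply: eq_bigr => i _; rewrite mulrC. Qed.

Lemma dotDr u v w : dot u (v + w) = dot u v + dot u w.
Proof. by rewrite /dot mulmxDr mxE. Qed.

Lemma dotZr c u v : dot u (c *: v) = c * dot u v.
Proof. by rewrite /dot -scalemxAr mxE. Qed.

Lemma dotNr u v : dot u (- v) = - dot u v.
Proof. by rewrite -scaleN1r dotZr mulN1r. Qed.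

Lemma dotDl u v w : dot (v + w) u = dot v u + dot w u.
Proof. by rewrite dotC dotDr !(dotC u). Qed.

Lemma dotZl c u v : dot (c *: u) v = c * dot u v.
Proof. by rewrite dotC dotZr dotC. Qed.

Lemma dotNl u v : dot (- u) v = - dot u v.
Proof. by rewrite dotC dotNr dotC. Qed.

Lemma dot_ge0 u : 0 <= dot u u.
Proof. by rewrite dotE; apply: sumr_ge0 => i _; rewrite -expr2 sqr_ge0. Qed.

Lemma dot_mulmx_trl A u v : dot (A *m u) v = dot u (A^T *m v).
Proof. by rewrite /dot trmx_mul mulmxA. Qed.

Lemma loewner_scalarl A c v : loewner c%:M A -> c * dot v v <= dot v (A *m v).
Proof.
move=> [_ /(_ v)].
by rewrite -mulmxA mulmxBl mul_scalar_mx -/(dot _ _) dotDr dotNr dotZr subr_ge0.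
Qed.

Lemma loewner_scalarr A c v : loewner A c%:M -> dot v (A *m v) <= c * dot v v.
Proof.
move=> [_ /(_ v)].
by rewrite -mulmxA mulmxBl mul_scalar_mx -/(dot _ _) dotDr dotNr dotZr subr_ge0.
Qed.

Lemma loewner_scalarl_sym A c : loewner c%:M A -> A^T = A.
Proof.
move=> [+ _]; rewrite linearB /= tr_scalar_mx => h.
by rewrite -[LHS](subrK c%:M) h subrK.
Qed.

(** The matrix inequality [A^2 <= c A] without diagonalizing [A]: positivity of
    [A] at the vector [u - c^-1 A u], together with [A <= c I] at [A u],
    rearranges to this bound. *)
Lemma sqnorm_mulmx_le A c u : A^T = A -> (forall v, 0 <= dot v (A *m v)) ->
  0 < c -> (forall v, dot v (A *m v) <= c * dot v v) ->
  dot (A *m u) (A *m u) <= c * dot u (A *m u).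
Proof.
move=> Asym Apos c0 Ac; set y := A *m u.
have := Apos (u + - (c^-1 *: y)).
rewrite mulmxDr mulmxN -scalemxAr -/y dotDl !dotDr !dotNr !dotNl !dotZl !dotZr.
have -> : dot u (A *m y) = dot y y by rewrite -[in LHS]Asym -dot_mulmx_trl.
have h : c^-1 * (c^-1 * dot y (A *m y)) <= c^-1 * dot y y.
  rewrite ler_pM2l ?invr_gt0// mulrC ler_pdivrMr// mulrC; exact: Ac.
move=> h2; rewrite -ler_pdivrMl//; lra.
Qed.

End inner_product.

(** * Directional derivatives and second-order models *)

Section directional_derivatives.
Context {R : realType}.

(** The difference quotients of both sides are the same function, so this
    needs [f] to be derivable only in the direction of the line. *)
Lemma is_derive_line {V : normedModType R} {f : V -> R} x v t :
  derivable f (x + t *: v) v ->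
  is_derive t 1 (fun s => f (x + s *: v)) ('D_v f (x + t *: v)).
Proof.
move=> df.
have E : (fun h : R => h^-1 *: (((fun s => f (x + s *: v)) \o shift t)
             (h *: 1) - f (x + t *: v))) =
         (fun h : R => h^-1 *: ((f \o shift (x + t *: v)) (h *: v)
             - f (x + t *: v))).
  apply/funext => h /=; congr (_ *: (f _ - _)).
  by rewrite [h *: 1]mulr1 scalerDl addrCA.
apply: DeriveDef; first by rewrite /derivable E.
by rewrite /derive E.
Qed.

(** The half of Taylor's formula that gives the upper model; the lower one is
    this applied to [- f].  A bound on [f''] is enough, so [f''] need not be
    integrated: the mean value theorem is used twice. *)
Lemma taylor2_le (f f' f'' : R -> R) (c : R) :
  (forall t : R, is_derive t 1 f (f' t)) ->
  (forall t : R, is_derive t 1 f' (f'' t)) ->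
  (forall t, f'' t <= c) -> f 1 <= f 0 + f' 0 + c / 2.
Proof.
move=> df df' f''c.
have cont (h h' : R -> R) :
    (forall t : R, is_derive t 1 h (h' t)) -> continuous h.
  move=> dh t; apply: differentiable_continuous; apply/derivable1_diffP.
  exact: ex_derive.
(* [q] is [f] minus its parabola of curvature [c]; it is nonincreasing on [0, 1]. *)
pose q : R -> R := f + ((- f' 0) \*: id + (- (c / 2)) \*: (id ^+ 2)).
have dq (t : R) : is_derive t 1 q (f' t - f' 0 - c * t).
  have -> : f' t - f' 0 - c * t =
      f' t + ((- f' 0) *: 1 + (- (c / 2)) *: ((2%:R * t ^+ 1) *: 1)).
    by rewrite /GRing.scale /= expr1; lra.
  have did := is_derive_id t (1 : R).
  exact: is_deriveD (df t) (is_deriveD (is_deriveZ _ did)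
    (is_deriveZ _ (is_deriveX 2 did))).
have [s /[!in_itv]/= /andP[s0 s1] qs] : exists2 s, s \in `]0, 1[%R &
    q 1 - q 0 = (f' s - f' 0 - c * s) * (1 - 0).
  apply: MVT => //; apply: continuous_subspaceT; exact: cont dq.
have [r _ f's] : exists2 r, r \in `]0, s[%R & f' s - f' 0 = f'' r * (s - 0).
  apply: MVT => //; apply: continuous_subspaceT; exact: cont df'.
have : f'' r * s <= c * s by rewrite ler_pM2r.
move: qs f's; rewrite /q !fctE /= /GRing.scale /=; lra.
Qed.

End directional_derivatives.

Section models.
Context {R : realType} {d : nat}.
Implicit Types (f : 'cV[R]_d -> R) (x v : 'cV[R]_d).

Lemma derive_differentiableE f x v : differentiable f x ->
  'D_v f x = \sum_i v i 0 * 'D_(delta_mx i 0) f x.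
Proof.
move=> df; rewrite deriveE// [in LHS](matrix_sum_delta v) linear_sum.
apply: eq_bigr => i _.
by rewrite big_ord1 linearZ deriveE.
Qed.

Lemma derive_gradient f x v : differentiable f x ->
  'D_v f x = dot (gradient f x) v.
Proof.
move=> df; rewrite derive_differentiableE// dotE; apply: eq_bigr => i _.
by rewrite mxE mulrC.
Qed.

Lemma differentiable_partial f x i : differentiable (gradient f) x ->
  differentiable (fun y => 'D_(delta_mx i 0) f y : R) x.
Proof.
move=> dg.
have -> : (fun y => 'D_(delta_mx i 0) f y : R) =
          (fun N : 'cV[R]_d => N i 0 : R) \o gradient f.
  by apply/funext => y; rewrite /= mxE.
by apply: differentiable_comp => //; exact: differentiable_coord.
Qed.

(** The second derivative of [f] along a line is the quadratic form of the
    Hessian in the direction of the line. *)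
Lemma is_derive_gradient_line f x v (t : R) :
  (forall y, differentiable (gradient f) y) ->
  is_derive t 1 (fun s => dot (gradient f (x + s *: v)) v)
    (dot v (hessian f (x + t *: v) *m v)).
Proof.
move=> dg.
have -> : (fun s => dot (gradient f (x + s *: v)) v) =
    \sum_(i < d) (fun s => v i 0 * 'D_(delta_mx i 0) f (x + s *: v)).
  apply/funext => s; rewrite fct_sumE dotE; apply: eq_bigr => i _.
  by rewrite mxE mulrC.
rewrite dotE; apply: is_derive_sum => i.
have di := differentiable_partial f (x + t *: v) i (dg _).
rewrite mxE; apply: is_deriveZ.
have -> : \sum_j hessian f (x + t *: v) i j * v j 0 =
    'D_v (fun y => 'D_(delta_mx i 0) f y) (x + t *: v).
  rewrite derive_differentiableE//; apply: eq_bigr => j _.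
  by rewrite mxE mulrC.
by apply: (is_derive_line (f := fun y => 'D_(delta_mx i 0) f y));
   exact: diff_derivable.
Qed.

Lemma quadratic_upper_bound f x v (L : R) : twice_continuously_differentiable f ->
  (forall y, loewner (hessian f y) L%:M) ->
  f (x + v) <= f x + dot (gradient f x) v + L / 2 * dot v v.
Proof.
move=> [df dg _] hL.
have := @taylor2_le _ (fun t => f (x + t *: v)) _ _ (L * dot v v) _
  (fun t => is_derive_gradient_line f x v t dg) _.
rewrite scale1r scale0r addr0 mulrAC; apply => t.
  by rewrite -derive_gradient//; exact/is_derive_line/diff_derivable.
exact: loewner_scalarr.
Qed.

Lemma quadratic_lower_bound f x v (mu : R) : twice_continuously_differentiable f ->
  (forall y, loewner mu%:M (hessian f y)) ->
  f x + dot (gradient f x) v + mu / 2 * dot v v <= f (x + v).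
Proof.
move=> [df dg _] hmu.
have := @taylor2_le _ (- (fun t => f (x + t *: v)))
  (- (fun t => dot (gradient f (x + t *: v)) v)) _ (- (mu * dot v v)) _
  (fun t => is_deriveN (is_derive_gradient_line f x v t dg)) _.
rewrite !fctE scale1r scale0r addr0 => h.
suff /h : forall t : R, is_derive t 1 (- (fun t => f (x + t *: v)))
     (- dot (gradient f (x + t *: v)) v).
  move=> {}h; have: - f (x + v) <=
    - f x - dot (gradient f x) v + - (mu * dot v v) / 2.
    by apply: h => t; rewrite lerN2; exact: loewner_scalarl.
  lra.
move=> t; apply: is_deriveN; rewrite -derive_gradient//.
exact/is_derive_line/diff_derivable.
Qed.

(** Completing the square, [<g, v> + mu / 2 |v|^2 >= - |g|^2 / (2 mu)] for
    every [v], so the lower model bounds [f] below everywhere. *)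
Lemma polyak_lojasiewicz f x y (mu : R) : 0 < mu ->
  twice_continuously_differentiable f ->
  (forall z, loewner mu%:M (hessian f z)) ->
  2 * mu * (f x - f y) <= dot (gradient f x) (gradient f x).
Proof.
move=> mu0 f2 hmu; set g := gradient f x.
have := quadratic_lower_bound f x (y - x) mu f2 hmu.
rewrite addrCA subrr addr0 -/g; set v := y - x => lower.
have := dot_ge0 (g + mu *: v).
rewrite dotDl !dotDr !dotZl !dotZr (dotC v g) => square.
have : 2 * mu * (f x + dot g v + mu / 2 * dot v v) <= 2 * mu * f y.
  by rewrite ler_pM2l// mulr_gt0.
lra.
Qed.

Lemma gradient_average n (f : 'I_n -> 'cV[R]_d -> R) (F : 'cV[R]_d -> R) x :
  (forall y, F y = n%:R^-1 * \sum_(i < n) f i y) ->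
  (forall i, differentiable (f i) x) ->
  gradient F x = average (fun i => gradient (f i) x).
Proof.
move=> FE df; have -> : F = n%:R^-1 *: \sum_(i < n) f i.
  by apply/funext => y; rewrite FE fctE fct_sumE.
apply/colP => j; rewrite !mxE summxE.
have dfj i : derivable (f i) x (delta_mx j 0) by exact: diff_derivable.
rewrite deriveZ; last exact: derivable_sum.
rewrite derive_sum//; congr (_ * _); apply: eq_bigr => i _.
by rewrite mxE.
Qed.

(** * Contraction of the optimality gap *)

(** The step-size bound makes the quadratic term of the upper model at most
    half of the linear gain [alpha <g, A g>]; the other half is converted into
    optimality gap by the Polyak-Lojasiewicz inequality. *)
Lemma descent_step f x y (A : 'M[R]_d) (mu L mu1 mu2 alpha : R) :
  twice_continuously_differentiable f -> 0 < mu -> 0 < L ->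
  (forall z, loewner mu%:M (hessian f z) /\ loewner (hessian f z) L%:M) ->
  0 < mu1 -> mu1 <= mu2 -> loewner mu1%:M A -> loewner A mu2%:M ->
  0 < alpha -> alpha <= mu1 / (mu2 ^+ 2 * L) ->
  f (x - alpha *: (A *m gradient f x)) - f y <=
    (1 - alpha * mu * mu1) * (f x - f y).
Proof.
move=> f2 mu0 L0 fH mu10 mu12 A1 A2 a0 ale.
have mu20 : 0 < mu2 by exact: lt_le_trans mu12.
have PL := polyak_lojasiewicz f x y mu mu0 f2 (fun z => (fH z).1).
have := quadratic_upper_bound f x (- (alpha *: (A *m gradient f x))) L f2
  (fun z => (fH z).2).
move: PL; set g := gradient f x => PL.
rewrite !dotNr dotNl opprK dotZl !dotZr => upper.
have lo := loewner_scalarl A mu1 g A1.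
have Apos v : 0 <= dot v (A *m v).
  by apply: le_trans (loewner_scalarl A mu1 v A1); rewrite mulr_ge0 ?dot_ge0 ?ltW.
have sq := sqnorm_mulmx_le A mu2 g (loewner_scalarl_sym A mu1 A1) Apos mu20
  (fun v => loewner_scalarr A mu2 v A2).
(* alpha L mu2 <= mu1 / mu2 <= 1 *)
have step_small : alpha * L * mu2 <= 1.
  have := ale; rewrite ler_pdivlMr ?mulr_gt0 ?exprn_gt0// => h.
  rewrite -(ler_pM2r mu20); lra.
have h1 : alpha * (alpha * L) * dot (A *m g) (A *m g) <= alpha * dot g (A *m g).
  rewrite -[leLHS]mulrA ler_pM2l//.
  apply: (@le_trans _ _ (alpha * L * (mu2 * dot g (A *m g)))).
    by rewrite ler_pM2l// mulr_gt0.
  by rewrite mulrA ler_piMl.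
have h2 : alpha * (mu1 * dot g g) <= alpha * dot g (A *m g) by rewrite ler_pM2l.
have h3 : alpha * mu1 * (2 * mu * (f x - f y)) <= alpha * mu1 * dot g g.
  by rewrite ler_pM2l// mulr_gt0.
lra.
Qed.

End models.

(** If [q < 0], induction breaks down, but then [0 <= u k.+1 <= q * u k] forces
    [u] to vanish.  For the optimality gap this covers dimension [0], where the
    Hessian bounds do not imply [mu <= L]. *)
Lemma geometric_decay {R : realType} (u : nat -> R) (q : R) :
  (forall k, 0 <= u k) -> (forall k, u k.+1 <= q * u k) ->
  forall k, u k <= q ^+ k * u 0.
Proof.
move=> u0 uS; have [q0|q0] := leP 0 q.
  elim=> [|k IH]; first by rewrite expr0 mul1r.
  by apply: le_trans (uS k) _; rewrite exprS -mulrA ler_wpM2l.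
have uz k : u k = 0.
  apply/eqP; rewrite eq_le u0 andbT.
  by rewrite -(nmulr_rge0 _ q0); exact: le_trans (uS k).
by move=> k; rewrite !uz mulr0.
Qed.

Theorem theorem1 (R : realType) (d m n : nat) (n_gt0 : (0 < n)%N)
    (f : 'I_n -> 'cV[R]_d -> R) (F : 'cV[R]_d -> R)
    (F_def : forall w, F w = n%:R^-1 * \sum_(i < n) f i w)
    (F_C2 : twice_continuously_differentiable F)
    (mu L : R) (mu_gt0 : 0 < mu) (L_gt0 : 0 < L)
    (F_hess : forall w, loewner (mu%:M) (hessian F w) /\
                        loewner (hessian F w) (L%:M))
    (wstar : 'cV[R]_d) (wstar_argmin : forall w, F wstar <= F w)
    (inp : flecs_input R d m n) (inp_valid : valid_input inp)
    (tr : flecs_trace inp) (tr_run : flecs_run f tr)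
    (f_diff : forall i k, twice_differentiable_at (f i) (w_ tr k))
    (mu1 mu2 : R) (mu1_gt0 : 0 < mu1) (mu1_le_mu2 : mu1 <= mu2)
    (A_bounds : forall k, loewner (mu1%:M) (A_ tr k) /\
                          loewner (A_ tr k) (mu2%:M))
    (alpha : R) (alpha_const : forall k, alpha_ tr k = alpha)
    (alpha_gt0 : 0 < alpha) (alpha_le : alpha <= mu1 / (mu2 ^+ 2 * L)) :
  forall k : nat,
    F (w_ tr k) - F wstar <=
      (1 - alpha * mu * mu1) ^+ k * (F (w_ tr 0) - F wstar).
Proof.
apply: (geometric_decay (fun k => F (w_ tr k) - F wstar)) => k.
  by rewrite subr_ge0.
(* The direction uses the average of the workers' gradients; it is the
   gradient of [F] because every [f i] is differentiable at the iterate. *)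
have [_ _ /(_ k)[_ _ ->]] := tr_run.
rewrite -(gradient_average _ _ F)//; last first.
  by move=> i; have [/nbhs_singleton] := f_diff i k.
have [A1 A2] := A_bounds k; rewrite alpha_const scalerN.
by apply: (@descent_step _ _ _ _ _ _ _ L mu1 mu2).
Qed.
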